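(* Let $p_1,p_2,\dots,p_n$ be distinct points of a $d$-dimensional normed space $X^d$ such that $\|p_i-p_j\|=\|p_i-p_k\|$ whenever $1\leq i<j<k\leq n$. Then $n\leq 2^{5^{d+\mathrm{o}(d)}}$.
   Context: All normed spaces are real. The term $\mathrm{o}(d)$ denotes a function of $d$ only (independent of the normed space $X^d$ and of the points) whose ratio to $d$ tends to $0$ as $d\to\infty$. *)

(* Defs.v *)
From HB Require Import structures.
From mathcomp Require Import all_boot all_order all_algebra.
From mathcomp Require Import all_classical all_reals all_analysis.

Set Implicit Arguments.
Unset Strict Implicit.
Unset Printing Implicit Defensive.

(* Join of normedModType and vectType: normed spaces of
   finite dimension. The norm is an arbitrary one and the dimension of X is
   \dim {:X}, as for any vectType. *)
#[short(type="normedVectType")]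
HB.structure Definition NormedVector (R : numDomainType) :=
  {X of NormedModule R X & Vector R X}.

(* Main.v *)
(**
  Translate the last point to 0, so that |v_i - v_j| = |v_i| for i < j.  If
  moreover |v_j| <= 3/2 |v_i|, the unit vectors v_i/|v_i| and v_j/|v_j| are at
  distance at least 1/2.  Since |v_j| <= 2 |v_i| whenever i < j and
  (3/2)^2 > 2, the indices split into two classes in which all pairs satisfy
  |v_j| <= 3/2 |v_i|.  A 1/2-separated family of vectors of norm at most 1 has
  at most (4d+5)^d members: with respect to d members of the family (enlarged
  by a basis) of maximal |determinant|, all coordinates lie in [-1, 1] by
  Cramer's rule, and one concludes by the pigeonhole principle on a grid.
  This gives n <= 2 (4d+5)^d + 1, far below the stated bound.
*)
Require Import Defs.
From mathcomp Require Import all_boot all_order all_algebra.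
From mathcomp Require Import all_classical all_reals all_analysis.
From mathcomp Require Import zify ring lra.

Set Implicit Arguments.
Unset Strict Implicit.
Unset Printing Implicit Defensive.

Import Order.TTheory GRing.Theory Num.Theory.
Import numFieldNormedType.Exports VectorInternalTheory.
Local Open Scope classical_set_scope.
Local Open Scope ring_scope.

(** Cramer's rule: the matrix factors as the identity with row [i] replaced by [c], times [B];
    expanding the first factor along row [i] leaves only [c 0 i]. *)
Lemma det_replace_row (F : comNzRingType) (d : nat) (B : 'M[F]_d) (c : 'rV[F]_d)
    (i : 'I_d) :
  \det (\matrix_k (if k == i then c *m B else row k B)) = c 0 i * \det B.
Proof.
have -> : \matrix_k (if k == i then c *m B else row k B) =
    (\matrix_k (if k == i then c else row k 1%:M)) *m B.
  apply/row_matrixP => k; rewrite row_mul !rowK.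
  by case: ifP => // _; rewrite -row_mul mul1mx.
rewrite det_mulmx; congr (_ * _).
rewrite (expand_det_row _ i) (bigD1 i) //= big1 ?addr0 => [|j nji].
  rewrite mxE eqxx /cofactor -signr_odd oddD addbb expr0 mul1r.
  suff -> : row' i (col' i (\matrix_k (if k == i then c else row k 1%:M)))
      = 1%:M by rewrite det1 mulr1.
  apply/matrixP => k l; rewrite !mxE eq_sym (negPf (neq_lift _ _)).
  by rewrite !mxE (inj_eq lift_inj).
(* For [j != i] the minor keeps row [j] of the identity but loses column [j], so it has a zero
   row. *)
rewrite /cofactor; set M := row' _ _.
have [k ek] : exists k, j = lift i k.
  by case: (unliftP i j) nji => [k ->|->]; [exists k | rewrite eqxx].
rewrite (expand_det_row M k) big1 ?mulr0 // => l _.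
rewrite !mxE eq_sym (negPf (neq_lift _ _)) !mxE -ek.
by rewrite (negPf (neq_lift _ _)) mul0r.
Qed.

(** Take [f] of maximal |determinant|, nonzero thanks to [f0]. Putting [w s] in row [i] multiplies
    the determinant by the coordinate [c 0 i], so maximality forces this factor into [-1, 1]. *)
Lemma max_det_coord_le1 (F : realFieldType) (d : nat) (S : finType)
    (w : S -> 'rV[F]_d) (f0 : {ffun 'I_d -> S}) :
  \det (\matrix_k w (f0 k)) != 0 ->
  exists f : {ffun 'I_d -> S}, forall s, exists2 c : 'rV[F]_d,
    w s = \sum_i c 0 i *: w (f i) & forall i, `|c 0 i| <= 1.
Proof.
move=> f0P.
pose D (f : {ffun 'I_d -> S}) := `|\det (\matrix_k w (f k))|.
case: (@arg_maxP _ _ _ f0 xpredT D) => // f _ fmax.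
have Df : 0 < D f by apply: lt_le_trans (fmax f0 isT); rewrite normr_gt0.
set B := \matrix_k w (f k).
have Bu : B \in unitmx by rewrite unitmxE unitfE -normr_gt0.
exists f => s; exists (w s *m invmx B) => [|i].
  rewrite -[LHS](mulmxKV Bu) mulmx_sum_row.
  by apply: eq_bigr => i _; rewrite rowK.
have := fmax [ffun k => if k == i then s else f k] isT.
have := det_replace_row B (w s *m invmx B) i; rewrite mulmxKV //.
have -> : \matrix_k (if k == i then w s else row k B) =
  \matrix_k w ([ffun k => if k == i then s else f k] k).
  by apply/row_matrixP => k; rewrite !rowK ffunE; case: ifP.
by rewrite /D => ->; rewrite normrM /= ger_pMl.
Qed.

Lemma exists_small_coord (R : realType) (X : normedVectType R) (T : finType)
    (u : T -> X) :
  (forall t, `|u t| <= 1) ->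
  exists b : 'I_(dim X) -> X, (forall i, `|b i| <= 1) /\
    forall t, exists2 c : 'rV[R]_(dim X),
      u t = \sum_i c 0 i *: b i & forall i, `|c 0 i| <= 1.
Proof.
move=> u1.
pose e (i : 'I_(dim X)) : X := r2v (delta_mx 0 i).
have e0 i : `|e i| != 0.
  rewrite normr_eq0 -(inj_eq (can_inj v2rK)) linear0 r2vK.
  by apply/eqP => /matrixP /(_ 0 i) /eqP; rewrite !mxE !eqxx oner_eq0.
(* A basis is added to the family so that it spans X. *)
pose w (s : T + 'I_(dim X)) : X :=
  match s with inl t => u t | inr i => `|e i|^-1 *: e i end.
have w1 s : `|w s| <= 1.
  case: s => [t|i] //=.
  by rewrite normrZ normfV normr_id mulVf.
(* The rescaled basis serves as nondegenerate tuple: its matrix is diagonal with nonzero entries. *)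
have [|f fP] := @max_det_coord_le1 R (dim X) _ (v2r \o w) [ffun i => inr i].
  have -> : \matrix_k (v2r \o w) ([ffun i => inr i] k) =
      diag_mx (\row_i `|e i|^-1).
    apply/matrixP => i j; rewrite !mxE ffunE /= linearZ /= r2vK !mxE.
    by rewrite eqxx andTb eq_sym mulr_natr.
  rewrite det_diag; apply/prodf_neq0 => i _.
  by rewrite mxE invr_neq0.
exists (w \o f); split => [i|t] //=.
have [c cE c1] := fP (inl t); exists c => //.
apply: (can_inj v2rK); rewrite linear_sum /=.
rewrite -[v2r (u t)]/((v2r \o w) (inl t)) cE.
by apply: eq_bigr => i _; rewrite linearZ.
Qed.

Lemma truncn_eq_dist (R : realType) (x y : R) :
  0 <= x -> 0 <= y -> Num.truncn x = Num.truncn y -> `|x - y| < 1.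
Proof.
move=> x0 y0 xy.
have := truncn_itv x0; have := truncn_itv y0; rewrite xy -natr1.
by move=> /andP[? ?] /andP[? ?]; rewrite ltr_norml; apply/andP; split; lra.
Qed.

Lemma card_separated (R : realType) (X : normedVectType R) (T : finType)
    (u : T -> X) (k : nat) :
  (0 < k)%N -> (forall t, `|u t| <= 1) ->
  (forall s t, s != t -> k%:R^-1 <= `|u s - u t|) ->
  (#|T| <= (2 * (k * (dim X).+1)).+1 ^ dim X)%N.
Proof.
move=> k0 u1 usep.
have [b [b1 cP]] := exists_small_coord u1.
(* Vectors in one cell of a grid of mesh 1/N are at distance at most d/N. The factor [d.+1] makes
   this strictly less than 1/k and keeps N positive when d = 0. *)
set d := dim X in b b1 cP *; set N := (k * d.+1)%N.
have N0 : 0 < N%:R :> R by rewrite ltr0n muln_gt0 k0.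
have {cP} /choice[c cP] : forall t, exists c : 'rV[R]_d,
    u t = \sum_i c 0 i *: b i /\ forall i, `|c 0 i| <= 1.
  by move=> t; have [c ? ?] := cP t; exists c.
pose z t i := (c t 0 i + 1) * N%:R.
have z0 t i : 0 <= z t i.
  have [_ /(_ i)] := cP t; rewrite ler_norml => /andP[? ?].
  by apply: mulr_ge0; [lra | exact: ltW].
have zN t i : z t i <= (2 * N)%:R.
  have [_ /(_ i)] := cP t; rewrite ler_norml => /andP[? ?].
  by rewrite natrM ler_pM2r//; lra.
pose g t : {ffun 'I_d -> 'I_(2 * N).+1} :=
  [ffun i => inord (Num.truncn (z t i))].
suff g_inj : injective g.
  by have := leq_card g g_inj; rewrite card_ffun !card_ord.
move=> s t gst; apply/eqP/negPn/negP => /usep; apply/negP; rewrite -ltNge.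
have dc i : `|c s 0 i - c t 0 i| <= N%:R^-1.
  have /ffunP/(_ i)/(congr1 val) := gst; rewrite !ffunE /=.
  have tr r : (Num.truncn (z r i) < (2 * N).+1)%N.
    by rewrite ltnS -(ler_nat R) (le_trans _ (zN r i)) // truncn_le.
  rewrite !inordK // => /(truncn_eq_dist (z0 _ _) (z0 _ _)).
  rewrite /z -mulrBl (_ : _ + 1 - _ = c s 0 i - c t 0 i); last by ring.
  rewrite normrM (gtr0_norm N0) => h.
  by rewrite -[leRHS]mul1r ler_pdivlMr // ltW.
have -> : u s - u t = \sum_i (c s 0 i - c t 0 i) *: b i.
  rewrite (cP s).1 (cP t).1 -sumrB.
  by apply: eq_bigr => i _; rewrite scalerBl.
apply: le_lt_trans (ler_norm_sum _ _ _) _.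
apply: (@le_lt_trans _ _ (\sum_(i < d) N%:R^-1)).
  apply: ler_sum => i _; rewrite normrZ -[leRHS]mulr1.
  by apply: ler_pM.
rewrite sumr_const card_ord -[_ *+ d]mulr_natl ltr_pdivrMr // /N natrM.
rewrite mulKf ?ltr_nat //.
by rewrite pnatr_eq0 -lt0n.
Qed.

(** Write [x - y] as the smaller norm times the difference of the unit vectors, plus or minus a
    multiple of one unit vector. With D the distance sought, the triangle inequality gives D >= 1 if
    |y| <= |x|, and D >= 2 - |y|/|x| >= 1/2 otherwise. *)
Lemma dist_normalized_ge (R : realType) (X : normedModType R) (x y : X) :
  x != 0 -> y != 0 -> `|x - y| = `|x| -> `|y| <= 3 / 2 * `|x| ->
  2^-1 <= `| `|x|^-1 *: x - `|y|^-1 *: y|.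
Proof.
rewrite -!normr_gt0 => x0 y0 xy yx; set D := `|_ - _|.
have nx : x = `|x| *: (`|x|^-1 *: x) by rewrite scalerA divff ?scale1r ?gt_eqF.
have ny : y = `|y| *: (`|y|^-1 *: y) by rewrite scalerA divff ?scale1r ?gt_eqF.
have n1 (v : X) : 0 < `|v| -> `| `|v|^-1 *: v| = 1.
  by move=> v0; rewrite normrZ normfV normr_id mulVf ?gt_eqF.
have [le_yx|lt_xy] := leP `|y| `|x|.
  have : `|x| <= `|y| * D + (`|x| - `|y|).
    rewrite -{1}xy {1}nx {1}ny.
    rewrite (_ : _ - _ = `|y| *: (`|x|^-1 *: x - `|y|^-1 *: y) +
                         (`|x| - `|y|) *: (`|x|^-1 *: x)); last first.
      by rewrite scalerBr scalerBl [RHS]addrC addrA subrK.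
    apply: le_trans (ler_normD _ _) _.
    by rewrite 2!normrZ !normr_id n1 // mulr1 ger0_norm ?subr_ge0.
  move=> h; have : `|y| * 1 <= `|y| * D by lra.
  by rewrite ler_pM2l //; lra.
have : `|x| <= `|x| * D + (`|y| - `|x|).
  rewrite -{1}xy {1}nx {1}ny.
  rewrite (_ : _ - _ = `|x| *: (`|x|^-1 *: x - `|y|^-1 *: y) -
                       (`|y| - `|x|) *: (`|y|^-1 *: y)); last first.
    by rewrite scalerBr scalerBl opprB addrA subrK.
  apply: le_trans (ler_normB _ _) _.
  by rewrite 2!normrZ !normr_id n1 // mulr1 gtr0_norm ?subr_gt0.
move=> h; have : `|x| * 2^-1 <= `|x| * D by lra.
by rewrite ler_pM2l.
Qed.

Lemma card_equidistant_later (R : realType) (X : normedVectType R) (m : nat)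
    (v : 'I_m -> X) :
  (forall i, v i != 0) ->
  (forall i j : 'I_m, (i < j)%N -> `|v i - v j| = `|v i|) ->
  (m <= 2 * (2 * (2 * (dim X).+1)).+1 ^ dim X)%N.
Proof.
move=> v0 vE.
pose steep (i j : 'I_m) := (i < j)%N && (3 / 2 * `|v i| < `|v j|).
have flat_card (A : {set 'I_m}) : {in A &, forall i j, ~~ steep i j} ->
    (#|A| <= (2 * (2 * (dim X).+1)).+1 ^ dim X)%N.
  move=> flatA; pose u (t : {i | i \in A}) := `|v (val t)|^-1 *: v (val t).
  rewrite -(card_sig (mem A)); apply: (@card_separated R X _ u) => // [t|s t].
    by rewrite /u normrZ normfV normr_id mulVf // normr_eq0.
  have sep (s' t' : {i | i \in A}) : (val s' < val t')%N ->
      2^-1 <= `|u s' - u t'|.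
    move=> lt_st; apply: dist_normalized_ge; rewrite ?v0 ?vE //.
    have := flatA _ _ (valP s') (valP t').
    by rewrite /steep lt_st -leNgt.
  rewrite -val_eqE neq_ltn => /orP[/sep //|/sep].
  by rewrite distrC.
(* A chain steep i j, steep j k would give |v k| > 9/4 |v i|, whereas
   |v k| <= |v k - v i| + |v i| = 2 |v i|: so neither A nor its complement
   contains a steep pair. *)
pose A : {set 'I_m} := [set j | [exists i, steep i j]]%SET.
rewrite -[m in (m <= _)%N]card_ord -(cardsC A) mul2n -addnn leq_add //.
  apply: flat_card => j k; rewrite inE => /existsP[i /andP[ij lt_ij]] _.
  apply/negP => /andP[jk lt_jk].
  have : `|v k| <= `|v i - v k| + `|v i|.
    by rewrite distrC -{1}(subrK (v i) (v k)) ler_normD.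
  by rewrite vE ?(ltn_trans ij) // => h; have := normr_ge0 (v i); lra.
by apply: flat_card => i j _; rewrite !inE => /existsPn /(_ i).
Qed.

(** Since 4d+5 <= 2^(d+3), it suffices that (d+3)d+2 = (d+1)(d+2) <= 5^(d+1), which follows from d+1
    <= 2^d and 4^d <= 5^d. *)
Lemma exponent_bound (d : nat) :
  ((2 * (2 * (2 * d.+1)).+1 ^ d).+1 <= 2 ^ (5 ^ d.+1))%N.
Proof.
have d1 : (d.+1 <= 2 ^ d)%N by apply: ltn_expl.
have base : ((2 * (2 * d.+1)).+1 <= 2 ^ (d + 3))%N by rewrite expnD; lia.
have : (2 * (2 * (2 * d.+1)).+1 ^ d < 2 ^ ((d + 3) * d + 2))%N.
  have : ((2 * (2 * d.+1)).+1 ^ d <= 2 ^ ((d + 3) * d))%N.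
    by rewrite expnM; case: d base {d1} => // d base; rewrite leq_exp2r.
  have : (0 < 2 ^ ((d + 3) * d))%N by rewrite expn_gt0.
  by rewrite (expnD 2 _ 2); lia.
move=> /leq_trans; apply; rewrite leq_exp2l //.
have : (2 ^ d * 2 ^ d <= 5 ^ d)%N.
  by rewrite -expnMn; case: d {d1 base} => // d; rewrite leq_exp2r.
by rewrite expnS; nia.
Qed.

Theorem theorem38 (R : realType) :
  exists e : nat -> R,
    (fun d : nat => e d / d%:R) @ \oo --> (0 : R) /\
    forall (d : nat) (X : normedVectType R) (n : nat) (p : 'I_n -> X),
      \dim {:X} = d ->
      injective p ->
      (forall i j k : 'I_n, (i < j)%N -> (j < k)%N ->
         `|p i - p j| = `|p i - p k|) ->
      n%:R <= (2 : R) `^ (5 `^ (d%:R + e d)).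
Proof.
exists (fun=> 1); split.
  (* The shift skips d = 0 and yields the harmonic sequence. *)
  rewrite -cvg_shiftS /=; under eq_fun do rewrite mul1r.
  exact: cvg_harmonic.
move=> d X n p dX p_inj pE.
have -> : (2 : R) `^ (5 `^ (d%:R + 1)) = (2 ^ (5 ^ d.+1))%:R.
  by rewrite natr1 powR_mulrn // -natrX powR_mulrn // -natrX.
rewrite ler_nat; apply: leq_trans (exponent_bound d).
rewrite dimvf in dX; rewrite -dX.
case: n p p_inj pE => // m p p_inj pE; rewrite ltnS.
(* The hypothesis with [k] the last index gives the condition on [v]; the last point itself accounts
   for the [.+1] in the bound. *)
pose v (i : 'I_m) := p (widen_ord (leqnSn m) i) - p ord_max.
apply: (@card_equidistant_later R X m v) => [i|i j ij].
  rewrite subr_eq0; apply/eqP => /p_inj /(congr1 val) /= im.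
  by have := ltn_ord i; rewrite im ltnn.
by rewrite /v opprB addrA subrK; apply: pE => /=.
Qed.
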